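(* Let $A$ be a finite set of agents. A formula $\phi\in\mathcal{L}(A)$ is valid on all $\mathsf{eF}$-models for $A$ if and only if it is valid on all finite $\mathsf{eF}$-models for $A$.
   Context: Fix a countable set $\mathrm{Prop}$ of propositional variables and a finite set $A$ of agents. $\mathcal{L}(A)$ is the set of formulas $\phi ::= p \mid {\sim}\phi \mid (\phi\wedge\phi)\mid(\phi\to\phi)\mid \Box_a\phi$ with $p\in\mathrm{Prop}$, $a\in A$. An epistemic frame for $A$ is a tuple $\langle W,\langle R_a\rangle_{a\in A}\rangle$ with $W\neq\varnothing$ and each $R_a$ an equivalence relation on $W$. An $\mathsf{eF}$-model for $A$ is a tuple $M=\langle W,\langle R_a\rangle_{a\in A},\langle T_a\rangle_{a\in A},v\rangle$ where $\langle W,\langle R_a\rangle_{a\in A}\rangle$ is an epistemic frame, $v:\mathrm{Prop}\times W\to[0,1]$, and each $T_a$ maps $W$ to finite subsets of $[0,1]$ so that (i) $\{0,\frac12,1\}\subseteq T_a(w)$ for all $w\in W$; (ii) $x\in T_a(w)$ implies $1-x\in T_a(w)$; (iii) $wR_aw'$ implies $T_a(w)=T_a(w')$. The model is finite if $W$ is finite. The valuation extends to all formulas by $v({\sim}\phi,w)=1-v(\phi,w)$; $v(\phi\wedge\chi,w)=\min(v(\phi,w),v(\chi,w))$; $v(\phi\to\chi,w)=1$ if $v(\phi,w)\le v(\chi,w)$ and $v(\chi,w)$ otherwise; $v(\Box_a\phi,w)=\max\{x\in T_a(w)\mid x\le\inf\{v(\phi,w')\mid wR_aw'\}\}$. A formula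 $\phi$ is valid on a class of $\mathsf{eF}$-models if $v(\phi,w)=1$ for every model in the class and every state $w$ in it. *)

(* Defs.v *)
From mathcomp Require Import all_boot all_order all_algebra finmap.
From mathcomp Require Import all_classical all_reals.

Set Implicit Arguments.
Unset Strict Implicit.
Unset Printing Implicit Defensive.

Import Order.TTheory GRing.Theory Num.Theory.
Local Open Scope classical_set_scope.
Local Open Scope ring_scope.

Inductive formula (V A : Type) : Type :=
| Var of V
| Neg of formula V A
| And of formula V A & formula V A
| Imp of formula V A & formula V A
| Box of A & formula V A.

Record epistemic_frame (A : finType) := EpistemicFrame {
  world :> Type;
  world_nonempty : inhabited world;
  acc : A -> world -> world -> Prop;
  acc_equiv : forall a, RelationClasses.Equivalence (acc a)
}.

Record eF_model (R : realType) (V : countType) (A : finType) := EFModel {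
  frame :> epistemic_frame A;
  tset : A -> frame -> {fset R};
  tset_itv : forall a w x, x \in tset a w -> 0 <= x <= 1;
  tset_base : forall a w,
    [/\ 0 \in tset a w, 2^-1 \in tset a w & 1 \in tset a w];
  tset_compl : forall a w x, x \in tset a w -> 1 - x \in tset a w;
  tset_acc : forall a w w', acc a w w' -> tset a w = tset a w';
  valuation : V -> frame -> R;
  valuation_itv : forall p w, 0 <= valuation p w <= 1
}.

Section Semantics.
Variables (R : realType) (V : countType) (A : finType).

(* In the Box clause the default value 0 of the iterated maximum is harmless:
   0 belongs to the set being maximised over, and all its elements are
   nonnegative; see eval_Box_max. *)
Fixpoint eval (M : eF_model R V A) (phi : formula V A) (w : M) : R :=
  match phi with
  | Var p => valuation p w
  | Neg phi => 1 - eval phi w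
  | And phi chi => Num.min (eval phi w) (eval chi w)
  | Imp phi chi =>
      if eval phi w <= eval chi w then 1 else eval chi w
  | Box a phi =>
      \big[Num.max/0]_(x <- tset a w
                         | x <= inf [set eval phi w' | w' in acc a w]) x
  end.

Definition finite_model (M : eF_model R V A) : Prop := finite_set [set: M].

Definition valid_on (C : eF_model R V A -> Prop) (phi : formula V A) : Prop :=
  forall M, C M -> forall w : M, eval phi w = 1.

Lemma eval_itv (M : eF_model R V A) (phi : formula V A) (w : M) :
  0 <= eval phi w <= 1.
Proof.
elim: phi w => [p|phi IH|phi IH1 chi IH2|phi IH1 chi IH2|a phi IH] w /=.
- exact: valuation_itv.
- by have /andP[h0 h1] := IH w; rewrite subr_ge0 h1 gerBl h0.
- by rewrite minElt; case: ifP => _; [exact: IH1|exact: IH2].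
- by case: ifP => _; [rewrite ler01 lexx|exact: IH2].
- rewrite big_seq_cond.
  apply: (big_ind (fun x : R => 0 <= x <= 1)); first by rewrite lexx ler01.
  + by move=> x y hx hy; rewrite maxElt; case: ifP.
  + by move=> x /andP[/tset_itv].
Qed.

Lemma eval_Box_max (M : eF_model R V A) (a : A) (phi : formula V A) (w : M) :
  let S := [set x | x \in tset a w /\
                    x <= inf [set eval phi w' | w' in acc a w]] in
  S (eval (Box a phi) w) /\ ubound S (eval (Box a phi) w).
Proof.
split => /=; last by move=> x [xT xle]; exact: le_bigmax_seq.
rewrite big_seq_cond; set i := inf _.
apply: (big_ind (fun x : R => x \in tset a w /\ x <= i)).
- have [T0 _ _] := tset_base a w; split => //.
  apply: lb_le_inf.
    by exists (eval phi w), w => //=; case: (@acc_equiv A M a) => refl _ _; exact: refl.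
  by move=> _ [w' _ <-]; have /andP[] := eval_itv phi w'.
- by move=> x y hx hy; rewrite maxElt; case: ifP.
- by move=> x /andP[].
Qed.

End Semantics.

(* Main.v *)
Require Import Defs.
From mathcomp Require Import all_boot all_order all_algebra finmap.
From mathcomp Require Import all_classical all_reals.

(** The point is that a value below 1 at a world of an arbitrary model can be
    reproduced in a finite one.

    Since each [tset a w] is finite, a box is decided by its lower bound and a
    single world, although the infimum it refers to need not be attained: some
    accessible world already takes a value below every element of [tset a w]
    that exceeds the value of the box ([eval_BoxP]).  So a part of the
    class of [w] that contains such a world gives the box the same value, with
    the same truth values [tset a w].

    It remains to keep only finitely many worlds.  Under several equivalence
    relations the worlds that can be reached from [w] by choosing witnesses
    again and again may be infinitely many, but a formula with [n] boxes looks
    at most [n] steps deep.  The finite model is therefore a partial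
    unravelling ([unravel]): its worlds are the sequences of at most [n] boxed
    subformulas, read as successive choices of a witness in the original model
    ([realize]), and it inherits valuations and truth values from there.  The
    relation of an agent forgets the last choice if it was made by that agent
    ([strip]); as a sequence and its stripped form realize to accessible
    worlds, related sequences do as well.  Induction on the
    formula then shows that values are preserved at every sequence that leaves
    enough room for the boxes of the formula ([eval_unravel]). *)

Set Implicit Arguments.
Unset Strict Implicit.
Unset Printing Implicit Defensive.

Import Order.TTheory GRing.Theory Num.Theory.
Local Open Scope classical_set_scope.
Local Open Scope ring_scope.

Section Unravelling.
Variables (R : realType) (V : countType) (A : finType).
Implicit Types (M : eF_model R V A) (phi psi : formula V A) (a : A).

Lemma acc_refl M a (w : M) : acc a w w.
Proof. by case: (@acc_equiv A M a) => r _ _; exact: r. Qed.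

Lemma acc_sym M a (w u : M) : acc a w u -> acc a u w.
Proof. by case: (@acc_equiv A M a) => _ s _; exact: s. Qed.

Lemma acc_trans M a (w u t : M) : acc a w u -> acc a u t -> acc a w t.
Proof. by case: (@acc_equiv A M a) => _ _ t'; exact: t'. Qed.

Lemma le_inf_acc M a psi (w : M) (x : R) :
  x <= inf [set eval psi u | u in acc a w] <->
  (forall u, acc a w u -> x <= eval psi u).
Proof.
split=> [xle u wu|xle].
  apply: (le_trans xle); apply: ge_inf; last by exists u.
  by exists 0 => _ [t _ <-]; have /andP[] := eval_itv psi t.
apply: lb_le_inf; first by exists (eval psi w), w => //=; exact: acc_refl.
by move=> _ [u wu <-]; exact: xle.
Qed.

(** If every accessible world had a value above some element of [tset a w]
    that exceeds the value of the box, then the least such element would be a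
    lower bound, against the maximality of that value. *)
Lemma eval_Box_witness M a psi (w : M) :
  exists2 u, acc a w u &
    forall x, x \in tset a w -> x <= eval psi u -> x <= eval (Box a psi) w.
Proof.
have [[bT _] bub] := eval_Box_max a psi w.
move: (eval (Box a psi) w) bT bub => b bT bub.
apply: contrapT => /forall2NP noW.
have above u : acc a w u -> exists x, [/\ x \in tset a w, x <= eval psi u & b < x].
  case: (noW u) => // /existsNP[x] /not_implyP[xT] /not_implyP[xu /negP xb] _.
  by exists x; split=> //; rewrite ltNge.
have b1 : b < 1.
  have [x [/tset_itv/andP[_ x1] _ bx]] := above w (acc_refl a w).
  exact: lt_le_trans bx x1.
have [_ _ T1] := tset_base a w.
pose y := \big[Num.min/1]_(x <- tset a w | b < x) x.
have [yT by_] : y \in tset a w /\ b < y.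
  rewrite /y big_seq_cond.
  apply: (big_ind (fun x => x \in tset a w /\ b < x)) => //.
    by move=> x z hx hz; rewrite minElt; case: ifP.
  by move=> x /andP[].
have yle u : acc a w u -> y <= eval psi u.
  by move=> /above[x [xT xu bx]]; apply: (bigmin_inf_seq _ x).
have /= := bub y (conj yT (proj2 (le_inf_acc _ _ _ _) yle)).
by rewrite leNgt by_.
Qed.

(** This form mentions no infimum, so it transfers to a part of the class of
    [w] as soon as that part contains a witness. *)
Lemma eval_BoxP M a psi (w : M) (m : R) :
  eval (Box a psi) w = m <->
  [/\ m \in tset a w, forall u, acc a w u -> m <= eval psi u &
      exists2 u, acc a w u &
        forall x, x \in tset a w -> x <= eval psi u -> x <= m].
Proof.
have [[bT /le_inf_acc ble] bub] := eval_Box_max a psi w.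
split=> [<-|[mT mle [u wu um]]].
  by split=> //; exact: eval_Box_witness.
apply/eqP; rewrite eq_le um //=; last exact: ble.
by apply: bub; split=> //; exact/le_inf_acc.
Qed.

(** Classical equality turns the list into a finite type of letters. *)
Fixpoint boxes phi : seq {classic A * formula V A} :=
  match phi with
  | Var _ => [::]
  | Neg psi => boxes psi
  | And psi chi | Imp psi chi => boxes psi ++ boxes chi
  | Box a psi => ((a, psi) : {classic A * formula V A}) :: boxes psi
  end.

Section Paths.
Variables (M : eF_model R V A) (w0 : M) (phi : formula V A).

Definition letter : finType := seq_sub (boxes phi).
Definition agent (l : letter) : A := (ssval l).1.

Definition witness (l : letter) (w : M) : M :=
  s2val (cid2 (eval_Box_witness (agent l) (ssval l).2 w)).

Lemma acc_witness l w : acc (agent l) w (witness l w).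
Proof. by rewrite /witness; case: cid2. Qed.

Lemma witnessP l w x : x \in tset (agent l) w ->
  x <= eval (ssval l).2 (witness l w) ->
  x <= eval (Box (agent l) (ssval l).2) w.
Proof. by rewrite /witness; case: cid2 => u _ /= h; exact: h. Qed.

(* The latest choice is the head of the sequence. *)
Definition realize (s : seq letter) : M := foldr witness w0 s.

(** Sequences with equal [strip a] are to be related for [a].  Only one letter
    is removed, although the one below it may belong to [a] as well: no member
    of a class is then more than one letter longer than another, so passing to
    a related sequence uses up at most one letter. *)
Definition strip a (s : seq letter) : seq letter :=
  if s is l :: s' then if agent l == a then s' else s else [::].

Lemma size_strip a s : (size (strip a s) <= size s)%N.
Proof. by case: s => //= l s; case: ifP. Qed.

Lemma size_le_strip a s : (size s <= (size (strip a s)).+1)%N.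
Proof. by case: s => //= l s; case: ifP. Qed.

Lemma acc_strip a s : acc a (realize (strip a s)) (realize s).
Proof.
case: s => [|l s] /=; first exact: acc_refl.
by case: eqP => [<-|_]; [exact: acc_witness|exact: acc_refl].
Qed.

Lemma acc_realize a s t :
  strip a s = strip a t -> acc a (realize s) (realize t).
Proof.
move=> st; apply: acc_trans (acc_strip a t).
by rewrite -st; exact/acc_sym/acc_strip.
Qed.

Variable n : nat.

Definition unravel_acc a (s t : n.-bseq letter) : Prop :=
  strip a s = strip a t.

Lemma unravel_acc_equiv a : RelationClasses.Equivalence (unravel_acc a).
Proof.
by split=> [s|s t|s t u]; rewrite /unravel_acc // => -> //.
Qed.

Definition unravel_frame : epistemic_frame A :=
  EpistemicFrame (inhabits [bseq]) unravel_acc_equiv.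

Definition unravel : eF_model R V A :=
  @EFModel R V A unravel_frame
    (fun a s => tset a (realize s))
    (fun a s => @tset_itv _ _ _ M a (realize s))
    (fun a s => @tset_base _ _ _ M a (realize s))
    (fun a s => @tset_compl _ _ _ M a (realize s))
    (fun a s t st => tset_acc (acc_realize st))
    (fun p s => valuation p (realize s))
    (fun p s => @valuation_itv _ _ _ M p (realize s)).

Lemma unravel_finite : finite_model unravel.
Proof. exact: (@finite_finset (n.-bseq letter)). Qed.

(** The number of boxes stands for the modal depth that it bounds. *)
Lemma eval_unravel psi (s : n.-bseq letter) :
  {subset boxes psi <= boxes phi} ->
  (size s + size (boxes psi) <= n)%N ->
  eval (M := unravel) psi s = eval psi (realize s).
Proof.
elim: psi s => [p|psi IH|psi IHp chi IHc|psi IHp chi IHc|a psi IH] s //= sub.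
- by move=> le_n; rewrite IH.
- rewrite size_cat => le_n.
  rewrite IHp ?IHc //; do ?[by move=> x xb; apply: sub; rewrite mem_cat xb ?orbT].
  + by apply: leq_trans le_n; rewrite leq_add2l leq_addl.
  + by apply: leq_trans le_n; rewrite leq_add2l leq_addr.
- rewrite size_cat => le_n.
  rewrite IHp ?IHc //; do ?[by move=> x xb; apply: sub; rewrite mem_cat xb ?orbT].
  + by apply: leq_trans le_n; rewrite leq_add2l leq_addl.
  + by apply: leq_trans le_n; rewrite leq_add2l leq_addr.
rewrite addnS -addSn => le_n.
have subpsi : {subset boxes psi <= boxes phi}.
  by move=> x xb; apply: sub; rewrite inE xb orbT.
have IHs (t : n.-bseq letter) : unravel_acc a s t ->
    eval (M := unravel) psi t = eval psi (realize t).
  move=> st; apply: IH => //; apply: leq_trans le_n; rewrite leq_add2r.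
  apply: leq_trans (size_le_strip a t) _; rewrite ltnS -st.
  exact: size_strip.
have [bT ble _] := proj1 (eval_BoxP a psi (realize s) _) erefl.
apply/(eval_BoxP (M := unravel)); split=> //.
  by move=> t st; rewrite IHs //; exact/ble/acc_realize.
pose l : letter := SeqSub (sub _ (mem_head _ _)).
have size_ls : (size (l :: strip a s) <= n)%N.
  apply: leq_trans le_n; apply: leq_trans (leq_addr _ _).
  by rewrite /= ltnS size_strip.
pose t : n.-bseq letter := Bseq size_ls.
have st : unravel_acc a s t by rewrite /unravel_acc /= eqxx.
exists t => // x xT; rewrite (IHs _ st) => xle.
(* The witness was chosen for the stripped sequence, whose realization lies in
   the same class and hence gives the box the same value. *)
rewrite -[leRHS]/(eval (Box a psi) (realize s)).
have -> : eval (Box a psi) (realize s) = eval (Box a psi) (realize (strip a s)).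
  have ss := acc_strip a s.
  apply/eval_BoxP; have [cT cle [u su ux]] :=
    proj1 (eval_BoxP a psi (realize (strip a s)) _) erefl.
  rewrite -(tset_acc ss); split=> // [v sv|].
    by apply: cle; exact: acc_trans ss sv.
  by exists u => //; exact: acc_trans (acc_sym ss) su.
apply: (witnessP (l := l)) => //.
by rewrite (tset_acc (acc_strip a s)).
Qed.

End Paths.
End Unravelling.

Theorem corollary1 (R : realType) (V : countType) (A : finType)
    (phi : formula V A) :
  valid_on (fun _ : eF_model R V A => True) phi <->
  valid_on (@finite_model R V A) phi.
Proof.
split=> [valid M _ w|valid M _ w]; first exact: valid.
pose n := size (boxes phi).
have /= <- := @eval_unravel R V A M w phi n phi [bseq] (fun=> id) (leqnn n).
exact/valid/unravel_finite.
Qed.
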